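(* The lattice $\mathsf{B}(3,3)$ cannot be embedded (as a lattice) into any permutohedron $\mathsf{P}(\ell)$ ($\ell$ a positive integer).
   Context: $\mathsf{B}(3,3)$ is the lattice obtained by doubling the join of $3$ atoms in the Boolean lattice with $6$ atoms: take the Boolean lattice $B$ with atoms $\boldsymbol a_1,\boldsymbol a_2,\boldsymbol a_3,\boldsymbol b_1,\boldsymbol b_2,\boldsymbol b_3$, put $\boldsymbol a=\boldsymbol a_1\vee\boldsymbol a_2\vee\boldsymbol a_3$, and let $\mathsf{B}(3,3)=B\cup\{\boldsymbol p\}$ with a new element $\boldsymbol p$, where the order extends that of $B$ and, for $x\in B$, $x<\boldsymbol p$ iff $x\le\boldsymbol a$, and $\boldsymbol p<x$ iff $\boldsymbol a<x$. Permutohedra: let $[\ell]=\{1,\dots,\ell\}$ and $\mathcal{I}_\ell=\{(i,j)\in[\ell]\times[\ell] : i<j\}$. A subset $\boldsymbol x\subseteq\mathcal{I}_\ell$ is closed if it is transitive as a binary relation, and clopen if both $\boldsymbol x$ and $\mathcal{I}_\ell\setminus\boldsymbol x$ are closed. The permutohedron $\mathsf{P}(\ell)$ is the set of all clopen subsets of $\mathcal{I}_\ell$, ordered by inclusion; it is a lattice (isomorphic to the symmetric group on $\ell$ letters with the weak Bruhat order). A lattice embedding is an injective map preserving binary meets and joins. *)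

(* Defs.v *)
From HB Require Import structures.
From mathcomp Require Import all_boot all_order.

Set Implicit Arguments.
Unset Strict Implicit.
Unset Printing Implicit Defensive.

Import Order.TTheory.
Local Open Scope order_scope.

Definition lattice_embedding d (L : latticeType d) d' (L' : latticeType d')
    (f : L -> L') : Prop :=
  [/\ injective f,
      forall x y : L, f (x `&` y) = f x `&` f y
    & forall x y : L, f (x `|` y) = f x `|` f y].

(******************************************************************************)
(* The lattices B(m, n)                                                       *)
(******************************************************************************)

(* The Boolean lattice with atoms a_1, .., a_m, b_1, .., b_n is the powerset  *)
(* of 'I_m + 'I_n; [Some x] is the element x of it, and [None] is the new     *)
(* element p.                                                                 *)
Definition doubled_boolean (m n : nat) : Type := option {set 'I_m + 'I_n}.

HB.instance Definition _ (m n : nat) := Finite.copy (doubled_boolean m n) (option {set 'I_m + 'I_n}).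

Definition atoms_a (m n : nat) : {set 'I_m + 'I_n} := [set inl i | i : 'I_m].

Definition db_le (m n : nat) (x y : doubled_boolean m n) : bool :=
  match x, y with
  | Some x, Some y => x \subset y
  | Some x, None => x \subset atoms_a m n
  | None, Some y => atoms_a m n \proper y
  | None, None => true
  end.

(* When two sets strictly containing a meet in a, their greatest lower bound  *)
(* in B(m, n) is p rather than a.                                             *)
Definition db_meet (m n : nat) (x y : doubled_boolean m n) :
    doubled_boolean m n :=
  let a := atoms_a m n in
  match x, y with
  | Some x, Some y =>
      if [&& x :&: y == a, a \proper x & a \proper y] then None
      else Some (x :&: y)
  | Some z, None | None, Some z => if a \proper z then None else Some (a :&: z)
  | None, None => None
  end.

Definition db_join (m n : nat) (x y : doubled_boolean m n) :
    doubled_boolean m n :=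
  let a := atoms_a m n in
  match x, y with
  | Some x, Some y => Some (x :|: y)
  | Some z, None | None, Some z => if z \subset a then None else Some (a :|: z)
  | None, None => None
  end.

Lemma db_le_refl (m n : nat) : reflexive (@db_le m n).
Proof. by case=> [x|] /=. Qed.

Lemma db_le_anti (m n : nat) : antisymmetric (@db_le m n).
Proof.
case=> [x|] [y|] //=.
- by move=> xy; congr Some; apply/eqP; rewrite eqEsubset.
- by case/andP=> xa /(sub_proper_trans xa); rewrite properxx.
- by case/andP=> ay /(proper_sub_trans ay); rewrite properxx.
Qed.

Lemma db_le_trans (m n : nat) : transitive (@db_le m n).
Proof.
case=> [y|] [x|] [z|] //=.
- exact: subset_trans.
- exact: subset_trans.
- exact: proper_sub_trans.
- by move=> xa /proper_sub; apply: subset_trans.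
Qed.

Lemma db_leI (m n : nat) (x y z : doubled_boolean m n) :
  db_le x (db_meet y z) = db_le x y && db_le x z.
Proof.
set a := atoms_a m n.
case: y z => [y|] [z|] /=; rewrite -/a ?andbb //.
- case: ifP => [/and3P[/eqP yz ay az]|nyz].
    case: x => [x|] /=; last by rewrite -/a ay az.
    by rewrite -/a -yz subsetI.
  case: x => [x|] /=; rewrite -/a ?subsetI //.
  apply/idP/andP => [ayz|[ay az]].
    by split; apply: (proper_sub_trans ayz); rewrite ?subsetIl ?subsetIr.
  rewrite properEneq subsetI (proper_sub ay) (proper_sub az) !andbT.
  by rewrite eq_sym; apply/negP => yz; rewrite yz ay az in nyz.
- case: ifP => ay; case: x => [x|] /=; rewrite -/a ?ay //.
  + apply/idP/andP => [xa|[] //]; split=> //.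
    exact: subset_trans xa (proper_sub ay).
  + by rewrite subsetI andbC.
  + by apply/negP => /properP[_ [u]]; rewrite inE => /andP[ua _]; rewrite ua.
- case: ifP => az; case: x => [x|] /=; rewrite -/a ?az //.
  + apply/idP/andP => [xa|[] //]; split=> //.
    exact: subset_trans xa (proper_sub az).
  + by rewrite subsetI.
  + by apply/negP => /properP[_ [u]]; rewrite inE => /andP[ua _]; rewrite ua.
Qed.

Lemma db_leU (m n : nat) (x y z : doubled_boolean m n) :
  db_le (db_join x y) z = db_le x z && db_le y z.
Proof.
set a := atoms_a m n.
have aU (s t : {set 'I_m + 'I_n}) : (s \subset a) = false ->
    (a :|: s \subset t) = (s \subset t) && (a \proper t).
  move=> sa; rewrite subUset andbC; apply/andP/andP=> -[st at_]; split=> //.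
    rewrite properEneq at_ andbT; apply/eqP => ea.
    by rewrite ea st in sa.
  exact: proper_sub.
case: x y => [x|] [y|] /=; rewrite -/a ?andbb //.
- by case: z => [z|] /=; rewrite -/a subUset.
- case: ifP => xa; case: z => [z|] /=; rewrite -/a ?xa ?aU //.
  + apply/idP/andP => [az|[] //]; split=> //.
    exact: subset_trans xa (proper_sub az).
  + by rewrite xa.
- case: ifP => ya; case: z => [z|] /=; rewrite -/a ?ya ?aU //.
  + apply/idP/andP => [az|[] //]; split=> //.
    exact: subset_trans ya (proper_sub az).
  + by rewrite andbC.
  + by rewrite ya.
Qed.

Fact doubled_boolean_display : Order.disp_t. Proof. exact: Order.Disp. Qed.

HB.instance Definition _ (m n : nat) :=
  Order.Le_isPOrder.Build doubled_boolean_display (doubled_boolean m n)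
    (@db_le_refl m n) (@db_le_anti m n) (@db_le_trans m n).

HB.instance Definition _ (m n : nat) :=
  Order.POrder_MeetJoin_isLattice.Build doubled_boolean_display
    (doubled_boolean m n) (@db_leI m n) (@db_leU m n).

(******************************************************************************)
(* Permutohedra                                                               *)
(******************************************************************************)

(* The index set [l] = {1, .., l} is represented by 'I_l = {0, .., l - 1}.    *)
Definition incr_pairs (l : nat) : {set 'I_l * 'I_l} :=
  [set p : 'I_l * 'I_l | (p.1 < p.2)%N].

Definition closed_pairs (l : nat) (x : {set 'I_l * 'I_l}) : bool :=
  [forall i, forall j, forall k,
    ((i, j) \in x) && ((j, k) \in x) ==> ((i, k) \in x)].

Definition clopen_pairs (l : nat) (x : {set 'I_l * 'I_l}) : bool :=
  [&& x \subset incr_pairs l, closed_pairs x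
    & closed_pairs (incr_pairs l :\: x)].

Record permutohedron (l : nat) : Type := Permutohedron {
  perm_set :> {set 'I_l * 'I_l};
  _ : clopen_pairs perm_set
}.

HB.instance Definition _ (l : nat) := [isSub for @perm_set l].
HB.instance Definition _ (l : nat) := [Finite of permutohedron l by <:].

Definition perm_le (l : nat) (x y : permutohedron l) : bool :=
  perm_set x \subset perm_set y.

Lemma closed_pairsP (l : nat) (x : {set 'I_l * 'I_l}) :
  reflect (forall i j k, (i, j) \in x -> (j, k) \in x -> (i, k) \in x)
          (closed_pairs x).
Proof.
apply: (iffP forallP) => [cx i j k ij jk | cx i].
  by have /forallP/(_ j)/forallP/(_ k)/implyP := cx i; apply; rewrite ij.
by apply/forallP => j; apply/forallP => k; apply/implyP => /andP[]; apply: cx.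
Qed.

Lemma perm_setP (l : nat) (x : permutohedron l) :
  [/\ forall i j, (i, j) \in perm_set x -> (i < j)%N,
      forall i j k, (i, j) \in perm_set x -> (j, k) \in perm_set x ->
        (i, k) \in perm_set x
    & forall i j k : 'I_l, (i < j)%N -> (j < k)%N -> (i, k) \in perm_set x ->
        ((i, j) \in perm_set x) || ((j, k) \in perm_set x)].
Proof.
case: x => x /= /and3P[/subsetP sx /closed_pairsP cx /closed_pairsP ox].
split=> // [i j /sx|i j k ij jk ik]; first by rewrite inE.
apply/negPn/negP; rewrite negb_or => /andP[nij njk].
by have := ox i j k; rewrite !inE /= ij jk nij njk ik => /(_ isT isT).
Qed.

Lemma clopen_pairsI (l : nat) (x : {set 'I_l * 'I_l}) :
  (forall i j, (i, j) \in x -> (i < j)%N) ->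
  (forall i j k, (i, j) \in x -> (j, k) \in x -> (i, k) \in x) ->
  (forall i j k : 'I_l, (i < j)%N -> (j < k)%N -> (i, k) \in x ->
     ((i, j) \in x) || ((j, k) \in x)) ->
  clopen_pairs x.
Proof.
move=> sx cx ox; apply/and3P; split; last 2 first.
- exact/closed_pairsP.
- apply/closed_pairsP => i j k; rewrite !inE /= => /andP[nij ij] /andP[njk jk].
  rewrite (ltn_trans ij jk) andbT; apply/negP => /(ox _ _ _ ij jk).
  by rewrite (negPf nij) (negPf njk).
- by apply/subsetP => -[i j] /sx; rewrite inE.
Qed.

(* The transitive closure of u, when u is contained in [incr_pairs l].        *)
Definition trans_closure (l : nat) (u : {set 'I_l * 'I_l}) :
    {set 'I_l * 'I_l} :=
  [set p in incr_pairs l | connect (fun i j => (i, j) \in u) p.1 p.2].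

Lemma trans_closure_sub (l : nat) (u x : {set 'I_l * 'I_l}) :
    (forall i j, (i, j) \in u -> (i < j)%N) ->
    (forall i j k, (i, j) \in x -> (j, k) \in x -> (i, k) \in x) ->
  (trans_closure u \subset x) = (u \subset x).
Proof.
move=> su cx; apply/subsetP/subsetP => ux [i j].
  move=> ij; apply: ux; rewrite !inE /= (su _ _ ij) /=; exact: connect1.
rewrite !inE /= => /andP[ij /connectP[p pP jE]].
rewrite jE in ij *; elim: p i pP ij {j jE} => [|h p IHp] i /=.
  by rewrite ltnn.
case/andP=> ih hp _; have ih' := ux _ ih.
case: p hp IHp => [//|h' p] hp IHp; apply: cx ih' _; apply: IHp => //.
elim: p h h' hp {ih} => [|h'' p IHp] h h' /=; first by rewrite andbT => /su.
case/andP=> /su hh' hp; apply: ltn_trans hh' _; exact: IHp.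
Qed.

Lemma trans_closure_clopen (l : nat) (u : {set 'I_l * 'I_l}) :
    (forall i j, (i, j) \in u -> (i < j)%N) ->
    (forall i j k : 'I_l, (i < j)%N -> (j < k)%N -> (i, k) \in u ->
       ((i, j) \in u) || ((j, k) \in u)) ->
  clopen_pairs (trans_closure u).
Proof.
move=> su ou; apply: clopen_pairsI => [i j|i j k|i j k ij jk].
- by rewrite !inE => /andP[].
- rewrite !inE /= => /andP[ij cij] /andP[jk cjk].
  by rewrite (ltn_trans ij jk) (connect_trans cij cjk).
rewrite !inE /= ij jk (ltn_trans ij jk) /= => /connectP[p pP kE].
rewrite kE in jk *; elim: p i ij pP jk {k kE} => [|h p IHp] i ij /=.
  by rewrite ltnNge (ltnW ij).
case/andP=> ih hp jk; case: (ltngtP h j) => [hj|jh|/val_inj hj].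
- have /orP[hj'|->] := IHp h hj hp jk; last by rewrite orbT.
  by rewrite (connect_trans (connect1 ih) hj').
- have /orP[iju|jhu] := ou _ _ _ ij jh ih; first by rewrite connect1.
  apply/orP; right; apply: connect_trans (connect1 jhu) _.
  by apply/connectP; exists p.
- by rewrite -hj connect1.
Qed.

Lemma perm_join_subproof (l : nat) (x y : permutohedron l) :
  clopen_pairs (trans_closure (perm_set x :|: perm_set y)).
Proof.
have [sx _ ox] := perm_setP x; have [sy _ oy] := perm_setP y.
apply: trans_closure_clopen => [i j|i j k ij jk]; rewrite !inE.
  by case/orP=> [/sx|/sy].
by case/orP=> [/(ox _ _ _ ij jk)|/(oy _ _ _ ij jk)] /orP[]->; rewrite ?orbT.
Qed.

Definition perm_join (l : nat) (x y : permutohedron l) : permutohedron l :=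
  Permutohedron (perm_join_subproof x y).

Lemma perm_compl_subproof (l : nat) (x : permutohedron l) :
  clopen_pairs (incr_pairs l :\: perm_set x).
Proof.
case: x => x /= /and3P[sx cx ox]; apply/and3P; split=> //.
  exact: subsetDl.
by rewrite setDDr setDv set0U (setIidPr sx).
Qed.

Definition perm_compl (l : nat) (x : permutohedron l) : permutohedron l :=
  Permutohedron (perm_compl_subproof x).

(* Complementation in [incr_pairs l] is a dual automorphism of P(l).          *)
Definition perm_meet (l : nat) (x y : permutohedron l) : permutohedron l :=
  perm_compl (perm_join (perm_compl x) (perm_compl y)).

Lemma perm_le_refl (l : nat) : reflexive (@perm_le l).
Proof. by move=> x; apply: subxx. Qed.

Lemma perm_le_anti (l : nat) : antisymmetric (@perm_le l).
Proof. by move=> x y xy; apply/val_inj/eqP; rewrite eqEsubset. Qed.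

Lemma perm_le_trans (l : nat) : transitive (@perm_le l).
Proof. by move=> y x z; apply: subset_trans. Qed.

Lemma perm_leU (l : nat) (x y z : permutohedron l) :
  perm_le (perm_join x y) z = perm_le x z && perm_le y z.
Proof.
have [sx _ _] := perm_setP x; have [sy _ _] := perm_setP y.
have [_ cz _] := perm_setP z.
rewrite /perm_le /= trans_closure_sub ?subUset // => i j.
by rewrite inE => /orP[/sx|/sy].
Qed.

Lemma perm_le_compl (l : nat) (x y : permutohedron l) :
  perm_le x (perm_compl y) = perm_le y (perm_compl x).
Proof.
case: x y => x px [y py]; rewrite /perm_le /= !subsetD.
have /and3P[-> _ _] := px; have /and3P[-> _ _] := py.
by rewrite disjoint_sym.
Qed.

Lemma perm_leI (l : nat) (x y z : permutohedron l) :
  perm_le x (perm_meet y z) = perm_le x y && perm_le x z.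
Proof.
have complK (t : permutohedron l) : perm_compl (perm_compl t) = t.
  case: t => t pt; apply: val_inj => /=; have /and3P[st _ _] := pt.
  by rewrite setDDr setDv set0U (setIidPr st).
rewrite /perm_meet perm_le_compl perm_leU.
by rewrite -!(perm_le_compl x) !complK.
Qed.

Fact permutohedron_display : Order.disp_t. Proof. exact: Order.Disp. Qed.

HB.instance Definition _ (l : nat) :=
  Order.Le_isPOrder.Build permutohedron_display (permutohedron l)
    (@perm_le_refl l) (@perm_le_anti l) (@perm_le_trans l).

HB.instance Definition _ (l : nat) :=
  Order.POrder_MeetJoin_isLattice.Build permutohedron_display
    (permutohedron l) (@perm_leI l) (@perm_leU l).

(* Main.v *)
(* Suppose that B(3,3) embeds into P(l) and pick a pair in p but not in a.  A
   suitable set U turns P(l) into a Cambrian lattice, in which meets are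
   intersections and joins are transitive closures of unions, without
   identifying a and p.  Choose (i, j) in p but not in a with j - i minimal.
   For each k, (i, j) lies in a \/ b_k, and by minimality a path witnessing it
   contains a step (s_k, m_k) in b_k with (i, s_k) and (m_k, j) in a (or s_k = i,
   or m_k = j).  Since p /\ (a_h \/ a_h' \/ b_k) <= a, it is impossible that
   (i, s_k) and (m_k, j) each lie in a single atom a_h; by pigeonhole and symmetry
   (i, s_k) is in no a_h for two values k, k', say with s_k <= s_k'.  The step at
   which a path from i to s_k' in the union of the a_h passes s_k starts at some
   u > i with (i, u) in a and (u, j) in (a \/ b_k) /\ (a \/ b_k') = p, hence in
   a by minimality, so that (i, j) is in a. *)
Require Import Defs.
From mathcomp Require Import all_boot all_order.

Import Order.TTheory.

(** * Paths crossing a point of an abstract strict total order *)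

Section Crossing.
Variables (T : finType) (lt : rel T).
Hypotheses (lt_irr : irreflexive lt) (lt_trans : transitive lt)
  (lt_total : forall u v, [|| u == v, lt u v | lt v u]).

(** The first step of the path that ends beyond [s] serves. *)
Lemma connect_crossing (e : rel T) (x y s : T) :
    connect e x y -> (x == s) || lt x s -> lt s y ->
  exists u w, [/\ connect e x u, e u w, connect e w y, (u == s) || lt u s & lt s w].
Proof.
case/connectP=> q; elim: q x => [|z q IHq] x /=.
  move=> _ -> /orP[/eqP->|xs sx]; first by rewrite lt_irr.
  by have := lt_trans _ _ _ xs sx; rewrite lt_irr.
case/andP=> xz zq yE xs sy.
have [zs|nzs] := boolP ((z == s) || lt z s).
  have [u [w [zu uw wy us sw]]] := IHq z zq yE zs sy.
  by exists u, w; split=> //; apply: connect_trans zu; apply: connect1.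
exists x, z; split=> //; first by apply/connectP; exists q.
by have := lt_total z s; rewrite orbA (negPf nzs).
Qed.

Variables (I : finType) (A_ : I -> rel T) (A C1 C2 : rel T) (i j : T).
Hypotheses (A_lt : forall u v, A u v -> lt u v) (A_trans : transitive A)
  (A_A : forall k u v, A_ k u v -> A u v)
  (A_connect : forall u v, A u v -> connect [rel u v | [exists k, A_ k u v]] u v)
  (A_cut : forall k u z w, A i z -> lt z j -> A_ k u w -> lt u z -> lt z w ->
    A_ k u z)
  (C1_lt : forall u v, C1 u v -> lt u v) (C2_lt : forall u v, C2 u v -> lt u v)
  (AC1 : forall u v, A u v -> C1 u v) (AC2 : forall u v, A u v -> C2 u v)
  (C1_trans : transitive C1) (C2_trans : transitive C2)
  (C12 : forall u, A i u -> C1 u j -> C2 u j -> False).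

Lemma connect_A u v : connect [rel u v | [exists k, A_ k u v]] u v -> (u == v) || A u v.
Proof.
case/connectP=> q; elim: q u => [|z q IHq] u /=; first by move=> _ ->; rewrite eqxx.
case/andP=> /existsP[k /A_A uz] zq vE; apply/orP; right.
by have /orP[/eqP<- //|] := IHq z zq vE; apply: A_trans.
Qed.

(* The path from i to s2 has a step (u, w) passing s1, and C12 applies to u. *)
Lemma no_fork_le s1 s2 :
    A i s1 -> C1 s1 j -> A i s2 -> C2 s2 j -> ~ (exists k, A_ k i s1) ->
  (s1 == s2) || lt s1 s2 -> False.
Proof.
move=> is1 s1j is2 s2j big1 /orP[/eqP s12|s12].
  by apply: (@C12 s1) => //; rewrite s12.
have is1' : (i == s1) || lt i s1 by rewrite (A_lt _ _ is1) orbT.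
have [u [w [iu uw ws us sw]]] := connect_crossing _ _ _ _ (A_connect _ _ is2) is1' s12.
case/existsP: uw => k uw.
have us2 : A u s2.
  by have /orP[/eqP<-|] := connect_A _ _ ws; [|apply: A_trans]; apply: A_A uw.
have us2j : C2 u j by apply: C2_trans s2j; apply: AC2.
case/orP: us => [/eqP us1|us1]; first by apply: (@C12 s1) => //; rewrite -us1.
have us1k : A_ k u s1 by apply: A_cut uw _ _ => //; apply: C1_lt.
(* If [u] is [i], then [A_ k i s1] contradicts [big1]; otherwise [u] itself contradicts [C12]. *)
have /orP[/eqP iu'|iu'] := connect_A _ _ iu; first by apply: big1; exists k; rewrite iu'.
by apply: (@C12 u) => //; apply: C1_trans s1j; apply: AC1; apply: A_A us1k.
Qed.

End Crossing.

(** The hypotheses are symmetric under exchanging 1 and 2, so [s1] may be assumed not to exceed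
    [s2]. The order [lt] is abstract so that the lemma applies to the reversed order of the indices
    as well. *)
Lemma no_fork (T : finType) (lt : rel T) (I : finType) (A_ : I -> rel T)
    (A C1 C2 : rel T) (i j s1 s2 : T) :
    irreflexive lt -> transitive lt ->
    (forall u v, [|| u == v, lt u v | lt v u]) ->
    (forall u v, A u v -> lt u v) -> transitive A ->
    (forall k u v, A_ k u v -> A u v) ->
    (forall u v, A u v -> connect [rel u v | [exists k, A_ k u v]] u v) ->
    (forall k u z w, A i z -> lt z j -> A_ k u w -> lt u z -> lt z w -> A_ k u z) ->
    (forall u v, C1 u v -> lt u v) -> (forall u v, C2 u v -> lt u v) ->
    (forall u v, A u v -> C1 u v) -> (forall u v, A u v -> C2 u v) ->
    transitive C1 -> transitive C2 ->
    (forall u, A i u -> C1 u j -> C2 u j -> False) ->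
    A i s1 -> C1 s1 j -> ~ (exists k, A_ k i s1) ->
    A i s2 -> C2 s2 j -> ~ (exists k, A_ k i s2) ->
  False.
Proof.
move=> irr tr tot Alt Atr AA Acon Acut C1lt C2lt AC1 AC2 C1tr C2tr C12 is1 s1j b1 is2 s2j b2.
have [le12|] := boolP ((s1 == s2) || lt s1 s2).
  exact: (@no_fork_le T lt irr tr tot I A_ A C1 C2 i j _ _ _ _ _ _ _ _ _ _ _ s1 s2).
have := tot s1 s2; rewrite orbA => /orP[-> //|gt12] _.
apply: (@no_fork_le T lt irr tr tot I A_ A C2 C1 i j _ _ _ _ _ _ _ _ _ _ _ s2 s1) => //.
  by move=> u iu u1 u2; apply: C12 u2 u1.
by rewrite gt12 orbT.
Qed.

Lemma path_leq (l : nat) (e : rel 'I_l) (u : 'I_l) (q : seq 'I_l) :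
  (forall s t, e s t -> (s < t)%N) -> path e u q -> (u <= last u q)%N.
Proof.
move=> e_lt; elim: q u => //= z q IHq u /andP[/e_lt uz /IHq].
by apply: leq_trans; apply: ltnW.
Qed.

(** * Cambrian lattices and the permutohedron *)

Section Polar.
Variables (l : nat) (U : {set 'I_l}).

(* The join-irreducible <u, v; U> of the permutohedron. *)
Definition polar_pairs (u v : 'I_l) : {set 'I_l * 'I_l} :=
  [set q : 'I_l * 'I_l | [&& (u <= q.1)%N, (q.1 < q.2)%N, (q.2 <= v)%N,
    (q.1 == u) || (q.1 \notin U) & (q.2 == v) || (q.2 \in U)]].

(** No two pairs compose, since their common point would lie both in [U] and outside it. When a pair
    is split at a middle point, the left part remains if that point is in [U], the right part if
    not. *)
Lemma polar_pairs_clopen u v : clopen_pairs (polar_pairs u v).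
Proof.
apply: clopen_pairsI => [s t|s t r|s t r st tr]; rewrite !inE /=.
- by case/and5P.
- case/and5P=> us st tv _ tU /and5P[_ tr rv tU' _].
  have tu : (t == u) = false by apply/eqP => tu; rewrite tu ltnNge us in st.
  have tv' : (t == v) = false by apply/eqP => tv'; rewrite tv' ltnNge rv in tr.
  by rewrite tu in tU'; rewrite tv' (negPf tU') in tU.
- case/and5P=> us sr rv sU rU.
  rewrite us st tr rv sU rU (ltnW (leq_trans tr rv)) (leq_trans us (ltnW st)) /=.
  by case: (t \in U); rewrite !orbT.
Qed.

Definition polar_elt u v : permutohedron l := Permutohedron (polar_pairs_clopen u v).

(* The largest member of the Cambrian lattice of U contained in x. *)
Definition polar (x : permutohedron l) : rel 'I_l :=
  fun u v => (u < v)%N && (polar_pairs u v \subset perm_set x).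

Lemma polarP (x : permutohedron l) (u v : 'I_l) :
  reflect ((u < v)%N /\ forall s t : 'I_l, (u <= s)%N -> (s < t)%N -> (t <= v)%N ->
             (s == u) || (s \notin U) -> (t == v) || (t \in U) -> (s, t) \in perm_set x)
          (polar x u v).
Proof.
apply: (iffP andP) => -[uv H]; split=> //.
  by move=> s t us st tv sU tU; apply: (subsetP H); rewrite inE /= us st tv sU tU.
by apply/subsetP => -[s t]; rewrite inE /= => /and5P[]; apply: H.
Qed.

Lemma polar_lt x u v : polar x u v -> (u < v)%N. Proof. by case/andP. Qed.

Lemma polar_in x u v : polar x u v -> (u, v) \in perm_set x.
Proof. by case/polarP=> uv H; apply: H; rewrite ?eqxx. Qed.

(** A pair straddling [v] is composed of (s, v) and (v, t); any other pair lies on one side of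
    [v]. *)
Lemma polar_trans x : transitive (polar x).
Proof.
move=> v u w /polarP[uv Huv] /polarP[vw Hvw]; have [_ tx _] := perm_setP x.
apply/polarP; split=> [|s t us st tw sU tU]; first exact: ltn_trans vw.
have [tv|vt] := leqP t v.
  apply: Huv => //; case/orP: tU => [/eqP tw'|->]; last by rewrite orbT.
  by rewrite tw' leqNgt vw in tv.
have [vs|sv] := leqP v s.
  apply: Hvw => //; case/orP: sU => [/eqP su|->]; last by rewrite orbT.
  by rewrite su leqNgt uv in vs.
by apply: (tx s v t); [apply: Huv|apply: Hvw]; rewrite ?eqxx // ltnW.
Qed.

Lemma polar_cut x (u z w : 'I_l) : polar x u w -> (u < z)%N -> (z < w)%N ->
  if z \in U then polar x u z else polar x z w.
Proof.
case/polarP=> uw H uz zw; case: ifPn => zU; apply/polarP; split=> // s t us st tv sU tU.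
  apply: H => //; first exact: leq_trans tv (ltnW zw).
  by case/orP: tU => [/eqP->|->]; rewrite ?zU orbT.
apply: H => //; first exact: leq_trans (ltnW uz) us.
by case/orP: sU => [/eqP->|->]; rewrite ?zU orbT.
Qed.

Lemma polar_le (x y : permutohedron l) u v : (x <= y)%O -> polar x u v -> polar y u v.
Proof. by move=> xy /andP[uv H]; rewrite /polar uv; apply: subset_trans xy. Qed.

(** A meet in P(l) can be smaller than the intersection, but [polar_elt u v] lies below both [x] and
    [y], hence below their meet. *)
Lemma polar_meet (x y : permutohedron l) u v :
  polar x u v -> polar y u v -> polar (x `&` y)%O u v.
Proof.
case/andP=> uv xH /andP[_ yH]; rewrite /polar uv.
suff: (polar_elt u v <= x `&` y)%O by [].
by rewrite lexI; apply/andP.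
Qed.

(** Openness splits (s, m) at [t'] and then (s, t') at [s']; each time the unwanted part would be a
    shorter competitor of (s, m). *)
Lemma polar_minimal (x : permutohedron l) (s m : 'I_l) :
    (s, m) \in perm_set x ->
    (forall s' m' : 'I_l, (s <= s')%N -> (m' <= m)%N -> (s' == s) || (s' \in U) ->
      (m' == m) || (m' \notin U) -> (s', m') \in perm_set x -> s' = s /\ m' = m) ->
  polar x s m.
Proof.
have [ltx _ cox] := perm_setP x => sm minsm.
apply/polarP; split=> [|s' t' ss st tm sU tU]; first exact: ltx.
have st' : (s, t') \in perm_set x.
  have [->//|tm'] := eqVneq t' m; rewrite (negPf tm') /= in tU.
  have tltm : (t' < m)%N by rewrite ltn_neqAle tm tm'.
  have /orP[//|tmx] := cox _ _ _ (leq_ltn_trans ss st) tltm sm.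
  have [||||ts _] := minsm t' m _ _ _ _ tmx; rewrite ?tU ?eqxx ?orbT //.
    exact: leq_trans ss (ltnW st).
  by rewrite ts ltnNge ss in st.
have [->//|ss'] := eqVneq s' s; rewrite (negPf ss') /= in sU.
have slts : (s < s')%N by rewrite ltn_neqAle ss eq_sym ss'.
have /orP[ssx|//] := cox _ _ _ slts st st'.
have [||||_ sm'] := minsm s s' _ _ _ _ ssx; rewrite ?sU ?eqxx ?orbT //.
  exact: leq_trans (ltnW st) tm.
by rewrite sm' ltnNge tm in st.
Qed.

(* On an x-y path from u to v take a step (s, m) from U or u to the complement
   of U or v; if it is chosen with m - s minimal then it lies in polar x or in
   polar y, while (u, s) and (m, v) are handled by induction. *)
Lemma polar_join (x y : permutohedron l) u v :
  polar (x `|` y)%O u v -> connect [rel u v | polar x u v || polar y u v] u v.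
Proof.
set e := [rel u v | _].
have [n] := ubnP (v - u); elim: n u v => // n IHn u v; rewrite ltnS => vu xyuv.
have uv := polar_lt _ _ _ xyuv.
pose good (q : 'I_l * 'I_l) := [&& (u <= q.1)%N, (q.2 <= v)%N, (q.1 == u) || (q.1 \in U),
  (q.2 == v) || (q.2 \notin U) & (q \in perm_set x) || (q \in perm_set y)].
have good_lt q : good q -> (q.1 < q.2)%N.
  have [ltx _ _] := perm_setP x; have [lty _ _] := perm_setP y.
  by case: q => s m /and5P[_ _ _ _ /orP[/ltx|/lty]].
(* The first step of the path that ends at [v] or outside [U] is good: all earlier ends lie in
   [U]. *)
have [q0 g0] : exists q, good q.
  have : (u, v) \in perm_set (perm_join x y) by exact: polar_in xyuv.
  rewrite !inE /= uv /= => /connectP[q].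
  have edge_lt (s m : 'I_l) : (s, m) \in perm_set x :|: perm_set y -> (s < m)%N.
    have [ltx _ _] := perm_setP x; have [lty _ _] := perm_setP y.
    by rewrite inE => /orP[/ltx|/lty].
  suff: forall w : 'I_l, (u <= w)%N -> (w == u) || (w \in U) -> (w < v)%N ->
      path (fun s m => (s, m) \in perm_set x :|: perm_set y) w q -> v = last w q ->
      exists q0, good q0 by apply; rewrite ?eqxx.
  elim: q => [|z q IHq] w uw wU wv /=.
    by move=> _ vw; rewrite vw ltnn in wv.
  case/andP=> wz zq vE; have zv : (z <= v)%N by rewrite vE; apply: path_leq zq.
  have [zU|zU] := boolP ((z == v) || (z \notin U)).
    by exists (w, z); rewrite /good /= uw zv wU zU; rewrite inE in wz.
  rewrite negb_or negbK in zU; have /andP[zv' zU'] := zU.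
  apply: (IHq z) => //; first exact: leq_trans uw (ltnW (edge_lt _ _ wz)).
    by rewrite zU' orbT.
  by rewrite ltn_neqAle zv zv'.
case: (arg_minnP (fun q : 'I_l * 'I_l => q.2 - q.1) g0) => -[s m] gsm minsm.
have sltm := good_lt _ gsm; rewrite /= in sltm.
have /and5P[/= us mv sU mU xysm] := gsm.
(* Competitors of (s, m) are good again, so minimal length forces equal ends; [z] stands for [x] or
   [y]. *)
have best z : (s, m) \in perm_set z ->
    (forall q, q \in perm_set z -> (q \in perm_set x) || (q \in perm_set y)) -> polar z s m.
  move=> smz zxy; apply: polar_minimal => // s' m' ss mm s'U m'U smz'.
  have g' : good (s', m').
    rewrite /good /= (leq_trans us ss) (leq_trans mm mv) zxy // andbT /=.
    apply/andP; split.
      by case/orP: s'U => [/eqP->|->]; rewrite ?sU ?orbT.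
    by case/orP: m'U => [/eqP->|->]; rewrite ?mU ?orbT.
  have := minsm _ g'; have := good_lt _ g'; rewrite /= => slt le.
  have es : s' = s :> nat.
    apply/eqP; rewrite eqn_leq ss andbT leqNgt; apply/negP => lts.
    have : (m' - s' < m - s)%N by apply: leq_ltn_trans (leq_sub2r _ mm) _; rewrite ltn_sub2l.
    by rewrite ltnNge le.
  split; apply: val_inj => //=; apply/eqP; rewrite eqn_leq mm /=.
  have smn : (s <= m')%N by rewrite -es ltnW.
  by move: le; rewrite es leq_subLR subnKC.
have esm : connect e s m.
  apply: connect1; case/orP: xysm => smz; apply/orP; [left|right]; apply: best => // q ->//.
  by rewrite orbT.
have eus : connect e u s.
  have [<-|su] := eqVneq s u; first exact: connect0.
  rewrite (negPf su) /= in sU; have ult : (u < s)%N by rewrite ltn_neqAle us eq_sym su.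
  have slv := leq_trans sltm mv.
  apply: IHn; first by apply: leq_trans vu; rewrite ltn_sub2r.
  by have := polar_cut _ _ _ _ xyuv ult slv; rewrite sU.
have emv : connect e m v.
  have [<-|mv'] := eqVneq m v; first exact: connect0.
  rewrite (negPf mv') /= in mU; have mlv : (m < v)%N by rewrite ltn_neqAle mv mv'.
  have ulm := leq_ltn_trans us sltm.
  apply: IHn; first by apply: leq_trans vu; rewrite ltn_sub2l.
  by have := polar_cut _ _ _ _ xyuv ulm mlv; rewrite (negPf mU).
exact: connect_trans eus (connect_trans esm emv).
Qed.

End Polar.

(** * Joins and meets of the generators of B(3,3) *)

Section DoubledBoolean.
Local Open Scope order_scope.

Definition elt_a : doubled_boolean 3 3 := Some (atoms_a 3 3).
Definition elt_p : doubled_boolean 3 3 := None.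
Definition elt_ai (k : 'I_3) : doubled_boolean 3 3 := Some [set inl k].
Definition elt_bj (k : 'I_3) : doubled_boolean 3 3 := Some [set inr k].

Lemma inr_notin_atoms_a (k : 'I_3) : (inr k \in atoms_a 3 3) = false.
Proof. by apply/imsetP => -[]. Qed.

Lemma inl_in_atoms_a (k : 'I_3) : inl k \in atoms_a 3 3.
Proof. exact: imset_f. Qed.

Lemma elt_a_le_p : elt_a <= elt_p. Proof. exact: subxx. Qed.

Lemma elt_ai_le_a k : elt_ai k <= elt_a.
Proof. by apply: (introT subsetP) => z /set1P->; apply: inl_in_atoms_a. Qed.

Lemma atoms_a_properU (k : 'I_3) : atoms_a 3 3 \proper atoms_a 3 3 :|: [set inr k].
Proof.
apply/properP; split; first exact: subsetUl.
by exists (inr k); rewrite ?inr_notin_atoms_a // !inE eqxx orbT.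
Qed.

Lemma elt_p_le_ab k : elt_p <= elt_a `|` elt_bj k.
Proof. exact: atoms_a_properU. Qed.

Lemma elt_ab_meet k k' : k != k' -> (elt_a `|` elt_bj k) `&` (elt_a `|` elt_bj k') = elt_p.
Proof.
move=> kk'; have : atoms_a 3 3 :|: [set inr k] :&: [set inr k'] = atoms_a 3 3.
  apply/setP => z; rewrite !inE; case: (z \in _) => //=.
  apply/negP => /andP[/eqP-> /eqP[kk]]; by rewrite kk eqxx in kk'.
rewrite setUIr => E.
by rewrite /Order.meet /= E eqxx !atoms_a_properU.
Qed.

Lemma elt_a_le_join (k0 k1 k2 : 'I_3) : (forall k, k \in [:: k0; k1; k2]) ->
  elt_a <= elt_ai k0 `|` elt_ai k1 `|` elt_ai k2.
Proof.
move=> all3; apply: (introT subsetP) => z /imsetP[k _ ->].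
by rewrite !inE; move: (all3 k); rewrite !inE => /or3P[]/eqP->; rewrite eqxx ?orbT.
Qed.

(** Two of the three atoms below a leave out some [q], so the join is not above a and its meet with
    p is a plain intersection with a. *)
Lemma elt_p_meet_le k k' m :
  elt_p `&` (elt_ai k `|` elt_ai k' `|` elt_bj m) <= elt_a.
Proof.
have [q /andP[qk qk']] : exists q, (q != k) && (q != k').
  have /card_gt0P[q] : (0 < #|~: [set k; k']|)%N.
    by rewrite cardsCs setCK card_ord subn_gt0 cards2; case: (k != k').
  by rewrite !inE negb_or => /andP[qk qk']; exists q; rewrite qk qk'.
rewrite /Order.meet /=; case: ifP => [/proper_sub/subsetP/(_ _ (inl_in_atoms_a q))|_].
  rewrite !inE -!orbA => /or3P[/eqP[E]|/eqP[E]|/eqP//].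
    by rewrite E eqxx in qk.
  by rewrite E eqxx in qk'.
exact: subsetIl.
Qed.

End DoubledBoolean.

(** * The contradiction from an embedding of B(3,3) *)

Theorem theorem11p1 (l : nat) (hl : 0 < l) :
  ~ exists f : doubled_boolean 3 3 -> permutohedron l, lattice_embedding f.
Proof.
case=> f [f_inj fI fU].
have f_le x y : (x <= y)%O -> (f x <= f y)%O.
  by move=> /meet_idPl xy; apply/meet_idPl; rewrite -fI xy.
have [[i0 j0] p0 a0] : exists2 q, q \in perm_set (f elt_p) & q \notin perm_set (f elt_a).
  apply/subsetPn/negP => pa.
  suff /f_inj : f elt_p = f elt_a by [].
  by apply: le_anti; apply/andP; split; [exact: pa|apply: f_le; apply: elt_a_le_p].
have [ltp _ cop] := perm_setP (f elt_p).
(* With this [U], openness of [f elt_p] at points outside [U] puts (i0, j0) in [D elt_p]. *)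
pose U := [set k | (i0, k) \in perm_set (f elt_p)].
pose D x := polar _ U (f x).
have P0 : D elt_p i0 j0.
  apply/polarP; split=> [|s t us st tv sU tU]; first exact: ltp.
  have i0t : (i0, t) \in perm_set (f elt_p).
    by case/orP: tU => [/eqP->//|]; rewrite inE.
  case/orP: sU => [/eqP->//|]; rewrite inE => is_.
  have [si|si] := eqVneq s i0; first by rewrite si.
  have lis : (i0 < s)%N by rewrite ltn_neqAle us eq_sym si.
  by have := cop _ _ _ lis st i0t; rewrite (negPf is_).
have nA0 : ~~ D elt_a i0 j0 by apply: contra a0; apply: polar_in.
(* [U] stays tied to [i0], while (i, j) is minimal among the pairs in [D elt_p] but not in
   [D elt_a]. *)
case: (@arg_minnP _ (i0, j0) (fun q => D elt_p q.1 q.2 && ~~ D elt_a q.1 q.2)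
  (fun q : 'I_l * 'I_l => q.2 - q.1)) => [|[i j] /= /andP[Pij nAij] minij]; first by rewrite P0.
have ij := polar_lt _ _ _ _ _ Pij.
have minA (u v : 'I_l) : (i <= u)%N -> (v <= j)%N -> (i < u)%N || (v < j)%N -> D elt_p u v -> D elt_a u v.
  move=> iu vj short Puv; apply: contraT => nAuv.
  have := minij (u, v); rewrite /= Puv nAuv leqNgt => /(_ isT)/negP[].
  case/orP: short => [lt|lt].
    by apply: leq_ltn_trans (leq_sub2r u vj) _; apply: ltn_sub2l.
  by apply: leq_ltn_trans (leq_sub2l v iu) _; apply: ltn_sub2r.
have D_le x y u v : (x <= y)%O -> D x u v -> D y u v by move/f_le; apply: polar_le.
have D_trans x : transitive (D x) by exact: polar_trans.
have D_lt x u v : D x u v -> (u < v)%N by exact: polar_lt.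
have D_meet x y u v : D x u v -> D y u v -> D (x `&` y)%O u v.
  by rewrite /D fI; apply: polar_meet.
have D_join x y u v : D (x `|` y)%O u v -> connect [rel u v | D x u v || D y u v] u v.
  by rewrite /D fU; apply: polar_join.
have cut (z : 'I_l) : (i < z)%N -> (z < j)%N ->
    if z \in U then D elt_a i z else D elt_a z j.
  move=> iz zj; have := polar_cut _ _ _ _ _ _ Pij iz zj.
  by case: ifP => _; apply: minA; rewrite ?iz ?zj ?orbT // ltnW.
have A_A k u v : D (elt_ai k) u v -> D elt_a u v by apply: D_le; apply: elt_ai_le_a.
have A_connect u v : D elt_a u v -> connect [rel u v | [exists k, D (elt_ai k) u v]] u v.
  set e := [rel u v | _].
  have e1 k s t : D (elt_ai k) s t -> connect e s t.
    by move=> st; apply: connect1; apply/existsP; exists k.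
  pose o0 : 'I_3 := @Ordinal 3 0 isT; pose o1 : 'I_3 := @Ordinal 3 1 isT.
  pose o2 : 'I_3 := @Ordinal 3 2 isT.
  have all3 k : k \in [:: o0; o1; o2] by case: k => [[|[|[|]]]].
  move/(D_le _ _ _ _ (elt_a_le_join _ _ _ all3))/D_join.
  apply: connect_sub => {u v} u v /= /orP[/D_join|]; last exact: e1.
  by apply: connect_sub => {u v} u v /= /orP[]; apply: e1.
pose C k := D (elt_a `|` elt_bj k)%O.
have AC k u v : D elt_a u v -> C k u v by apply: D_le; apply: leUl.
have C12 k k' u v : k != k' -> C k u v -> C k' u v -> D elt_p u v.
  by move=> kk' Cu Cu'; rewrite -(elt_ab_meet _ _ kk'); apply: D_meet.
have step k : exists s m, [/\ (s == i) || D elt_a i s, D (elt_bj k) s m &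
    (m == j) || D elt_a m j].
  have /D_join/connectP[q] := D_le _ _ _ _ (elt_p_le_ab k) Pij.
  suff: forall w : 'I_l, (w == i) || D elt_a i w ->
      path [rel u v | D elt_a u v || D (elt_bj k) u v] w q -> j = last w q -> exists s m, [/\ (s == i) || D elt_a i s,
        D (elt_bj k) s m & (m == j) || D elt_a m j] by apply; rewrite eqxx.
  (* Stop at the first [z] with (i, z) not in a: the step reaching it comes from [elt_bj k], and
     [cut] puts (z, j) in a unless [z] is [j]. *)
  elim: q => [|z q IHq] w iw /=.
    by move=> _ jw; move: iw; rewrite -jw (negPf nAij) orbF => /eqP ji; rewrite ji ltnn in ij.
  case/andP=> wz zq jE.
  have lwz : (w < z)%N by case/orP: wz => /D_lt.
  have zj : (z <= j)%N by rewrite jE; apply: path_leq zq => s t /orP[]/D_lt.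
  have iz : (i < z)%N by apply: leq_ltn_trans lwz; case/orP: iw => [/eqP->|/D_lt/ltnW].
  have [Aiz|nAiz] := boolP (D elt_a i z); first by apply: (IHq z); rewrite ?Aiz ?orbT.
  exists w, z; split=> //.
    case/orP: wz => // Awz; case/negP: nAiz.
    by case/orP: iw Awz => [/eqP->//|]; apply: D_trans.
  have [->|zj'] := eqVneq z j; first by rewrite ?eqxx.
  have zltj : (z < j)%N by rewrite ltn_neqAle zj zj'.
  by have := cut _ iz zltj; case: ifP => // _ Aiz; rewrite Aiz in nAiz.
have branch k :
    (exists s, [/\ D elt_a i s, C k s j & ~ exists h, D (elt_ai h) i s]) \/
    (exists m, [/\ D elt_a m j, C k i m & ~ exists h, D (elt_ai h) m j]).
  have [s [m [is_ sm mj]]] := step k.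
  have Csm : C k s m by apply: D_le sm; apply: leUr.
  have [sL|/norP[si nsL]] := boolP ((s == i) || [exists h, D (elt_ai h) i s]); last first.
    left; exists s; rewrite (negPf si) /= in is_; split=> //; last by move/existsP; apply/negP.
    by case/orP: mj => [/eqP<-//|/(AC k)]; apply: D_trans.
  have [mR|/norP[mj' nmR]] := boolP ((m == j) || [exists h, D (elt_ai h) m j]); last first.
    right; exists m; rewrite (negPf mj') /= in mj; split=> //; last by move/existsP; apply/negP.
    by case/orP: is_ => [/eqP<-//|/(AC k) is_]; apply: D_trans Csm.
  (* If [s] is [i], any index will do, and [ord0] is taken. *)
  have [h hs] : exists h, (s == i) || D (elt_ai h) i s.
    by case/orP: sL => [->|/existsP[h hs]]; [exists ord0|exists h; rewrite hs orbT].
  have [h' hm] : exists h, (m == j) || D (elt_ai h) m j.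
    by case/orP: mR => [->|/existsP[h' hm]]; [exists ord0|exists h'; rewrite hm orbT].
  pose x := (elt_ai h `|` elt_ai h' `|` elt_bj k)%O.
  have xsm : D x s m by apply: D_le sm; apply: leUr.
  have xsj : D x s j.
    case/orP: hm => [/eqP<-//|hm]; apply: D_trans xsm _.
    by apply: D_le hm; rewrite /x joinAC leUr.
  have xij : D x i j.
    case/orP: hs => [/eqP<-//|hs]; apply: D_trans xsj.
    by apply: D_le hs; rewrite /x -joinA leUl.
  case/negP: nAij; apply: D_le (elt_p_meet_le h h' k) _; exact: D_meet.
have fork_left k k' : k != k' ->
    (exists s, [/\ D elt_a i s, C k s j & ~ exists h, D (elt_ai h) i s]) ->
    (exists s, [/\ D elt_a i s, C k' s j & ~ exists h, D (elt_ai h) i s]) -> False.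
  move=> kk' [s1 [? ? ?]] [s2 [? ? ?]].
  apply: (@no_fork _ (fun u v : 'I_l => (u < v)%N) _ (fun h => D (elt_ai h)) (D elt_a)
    (C k) (C k') i j s1 s2) => //.
  - by move=> u; rewrite /= ltnn.
  - by move=> u v w; apply: ltn_trans.
  - by move=> u v; rewrite -val_eqE; case: ltngtP.
  - exact: D_lt.
  (* For [z] outside [U], [cut] would give (z, j) in a, and with (i, z) also (i, j). *)
  - move=> h u z w iz zj uw uz zw; have := polar_cut _ _ _ _ _ _ uw uz zw.
    case: ifPn => // zU _; have := cut _ (D_lt _ _ _ iz) zj; rewrite (negPf zU) => Azj.
    by case/negP: nAij; apply: D_trans Azj.
  - exact: D_lt.
  - exact: D_lt.
  - exact: AC.
  - exact: AC.
  - exact: D_trans.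
  - exact: D_trans.
  move=> u iu Cu Cu'; case/negP: nAij; apply: D_trans (iu) _.
  by apply: minA (C12 _ _ _ _ kk' Cu Cu'); rewrite ?(D_lt _ _ _ iu) // ltnW // (D_lt _ _ _ iu).
have fork_right k k' : k != k' ->
    (exists m, [/\ D elt_a m j, C k i m & ~ exists h, D (elt_ai h) m j]) ->
    (exists m, [/\ D elt_a m j, C k' i m & ~ exists h, D (elt_ai h) m j]) -> False.
  move=> kk' [m1 [? ? ?]] [m2 [? ? ?]].
  (* Mirror image: the order and all relations are reversed, and [i] and [j] exchange roles. *)
  apply: (@no_fork _ (fun u v : 'I_l => (v < u)%N) _ (fun h u v => D (elt_ai h) v u)
    (fun u v => D elt_a v u) (fun u v => C k v u) (fun u v => C k' v u) j i m1 m2) => //.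
  - by move=> u; rewrite /= ltnn.
  - by move=> u v w uv vw; apply: ltn_trans vw uv.
  - by move=> u v; rewrite -val_eqE; case: ltngtP.
  - by move=> u v; apply: D_lt.
  - by move=> u v w uv vw; apply: D_trans vw uv.
  - by move=> h u v; apply: A_A.
  - by move=> u v /A_connect; rewrite connect_rev.
  - move=> h u z w zj iz wu zu wz; have := polar_cut _ _ _ _ _ _ wu wz zu.
    case: ifPn => // zU _; have := cut _ iz (D_lt _ _ _ zj); rewrite zU => Aiz.
    by case/negP: nAij; apply: D_trans zj.
  - by move=> u v; apply: D_lt.
  - by move=> u v; apply: D_lt.
  - by move=> u v; apply: AC.
  - by move=> u v; apply: AC.
  - by move=> u v w uv vw; apply: D_trans vw uv.
  - by move=> u v w uv vw; apply: D_trans vw uv.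
  move=> u uj Cu Cu'; case/negP: nAij; apply: D_trans (uj).
  by apply: minA (C12 _ _ _ _ kk' Cu Cu'); rewrite ?(D_lt _ _ _ uj) ?orbT // ltnW // (D_lt _ _ _ uj).
(* Of the three indices [k], two fall on the same side. *)
have [L0|R0] := branch (@Ordinal 3 0 isT); have [L1|R1] := branch (@Ordinal 3 1 isT);
  have [L2|R2] := branch (@Ordinal 3 2 isT);
  by [apply: fork_left L0 L1 | apply: fork_left L0 L2 | apply: fork_left L1 L2
     | apply: fork_right R0 R1 | apply: fork_right R0 R2 | apply: fork_right R1 R2].
Qed.
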